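(* Let $L$ be a countable first-order language, let $\mathfrak{M}$ be an $L$-structure with domain $M$, and let $A\subseteq M$ be a set of parameters such that $cf(|M|)>\max(\aleph_0,|A|)$. Then $\mathfrak{M}$ contains $|M|$ elements that are $A$-typical, while the set of elements of $M$ that are not $A$-typical has cardinality strictly less than $|M|$.
   Context: For an $L$-structure $\mathfrak{M}$ with domain $M$ and $A\subseteq M$, $L(A)$ is $L$ augmented with constants (parameters) for the elements of $A$; a property of $L(A)$ is a formula $\phi(x)$ of $L(A)$ with exactly one free variable $x$. Its extension is $ext(\phi)=\{a\in M:\mathfrak{M}\models\phi(a)\}$. A set $X\subseteq M$ is a majority subset of $M$ if $|X|>|M\setminus X|$; for infinite $M$ this is equivalent to $|M\setminus X|<|M|$. A property $\phi(x)$ of $L(A)$ is $A$-typical (over $\mathfrak{M}$) if $ext(\phi)$ is a majority subset of $M$. An element $a\in M$ is $A$-typical if $\mathfrak{M}\models\phi(a)$ for every $A$-typical property $\phi(x)$ of $L(A)$. $cf(\kappa)$ denotes the cofinality of the cardinal $\kappa$. *)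

(* Defs.v *)
From mathcomp Require Import all_boot.
From mathcomp Require Import all_classical.

Set Implicit Arguments.
Unset Strict Implicit.
Unset Printing Implicit Defensive.

Local Open Scope classical_set_scope.
Local Open Scope card_scope.

(** * Cardinalities *)

Definition card_lt (T U : Type) (X : set T) (Y : set U) : Prop :=
  X #<= Y /\ ~ (Y #<= X).

Definition majority (T : Type) (X : set T) : Prop := card_lt (~` X) X.

(* A well-order on [T] whose order type is the cardinal [|T|], i.e. the least
   ordinal in bijection with [T]. [wochoice.well_order] is reflexive. *)
Definition initial_well_order (T : Type) (R : rel T) : Prop :=
  wochoice.well_order R /\
  forall x, card_lt [set y | R y x /\ y <> x] [set: T].

Definition cofinal (T : Type) (R : rel T) (C : set T) : Prop :=
  forall x, exists2 y, C y & R x y.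

(* [|K| = cf(|T|)]: [|K|] is the least cardinality of a cofinal subset of the
   cardinal [|T|]. *)
Definition is_cofinality (T U : Type) (K : set U) : Prop :=
  exists2 R : rel T, initial_well_order R &
    (exists2 C, cofinal R C & C #= K) /\
    (forall C, cofinal R C -> K #<= C).
Arguments is_cofinality T [U] K.

(** * First-order logic with equality *)

Record language := Language {
  fsym : Type;
  rsym : Type;
  farity : fsym -> nat;
  rarity : rsym -> nat }.

Definition countable_language (L : language) : Prop :=
  countable [set: fsym L] /\ countable [set: rsym L].

(* Variables are named by natural numbers; constants are the function symbols
   of arity [0]. *)
Inductive term (L : language) : Type :=
| Var of nat
| App (f : fsym L) of ('I_(farity f) -> term L).
Arguments Var {L}.

Inductive formula (L : language) : Type :=
| Bot
| Eq of term L & term L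
| Rel (r : rsym L) of ('I_(rarity r) -> term L)
| Imp of formula L & formula L
| All of nat & formula L.
Arguments Bot {L}.

Fixpoint term_vars (L : language) (t : term L) : set nat :=
  match t with
  | Var x => [set x]
  | App f ts => [set x | exists i, term_vars (ts i) x]
  end.

Fixpoint free_vars (L : language) (phi : formula L) : set nat :=
  match phi with
  | Bot => set0
  | Eq s t => term_vars s `|` term_vars t
  | Rel r ts => [set x | exists i, term_vars (ts i) x]
  | Imp phi psi => free_vars phi `|` free_vars psi
  | All x phi => free_vars phi `\ x
  end.

Record structure (L : language) (M : Type) := Structure {
  fun_interp : forall f : fsym L, ('I_(farity f) -> M) -> M;
  rel_interp : forall r : rsym L, ('I_(rarity r) -> M) -> Prop }.

Fixpoint eval (L : language) (M : Type) (S : structure L M) (e : nat -> M)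
    (t : term L) : M :=
  match t with
  | Var x => e x
  | App f ts => fun_interp S (fun i => eval S e (ts i))
  end.

Fixpoint sat (L : language) (M : Type) (S : structure L M) (e : nat -> M)
    (phi : formula L) : Prop :=
  match phi with
  | Bot => False
  | Eq s t => eval S e s = eval S e t
  | Rel r ts => rel_interp S (fun i => eval S e (ts i))
  | Imp phi psi => sat S e phi -> sat S e psi
  | All x phi => forall a, sat S (fun y => if y == x then a else e y) phi
  end.

Definition lang_params (L : language) (M : Type) (A : set M) : language :=
  @Language (fsym L + set_type A) (rsym L)
    (fun f => match f with inl f => farity f | inr _ => 0 end)
    (@rarity L).

Definition struct_params (L : language) (M : Type) (S : structure L M)
    (A : set M) : structure (lang_params L A) M :=
  @Structure (lang_params L A) M
    (fun f => match f return ('I_(@farity (lang_params L A) f) -> M) -> M with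
              | inl f => fun args => fun_interp S args
              | inr a => fun _ => val a
              end)
    (fun r => @rel_interp L M S r).

(** * Typicality *)

Record property (L : language) := Property {
  prop_formula : formula L;
  prop_var : nat;
  prop_free : free_vars prop_formula = [set prop_var] }.

Section Typicality.
Variables (L : language) (M : Type) (S : structure L M) (A : set M).

(* [phi(a)]: since [prop_var phi] is the only free variable of [phi], the
   values of the assignment [e] at the other variables are irrelevant. *)
Definition holds (phi : property (lang_params L A)) (a : M) : Prop :=
  forall e : nat -> M, e (prop_var phi) = a ->
    sat (struct_params S A) e (prop_formula phi).

Definition ext (phi : property (lang_params L A)) : set M :=
  [set a | holds phi a].

Definition typical_property (phi : property (lang_params L A)) : Prop :=
  majority (ext phi).

Definition typical (a : M) : Prop :=
  forall phi : property (lang_params L A), typical_property phi -> holds phi a.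

End Typicality.

(* Main.v *)
Require Import Defs.
From mathcomp Require Import all_boot.
From mathcomp Require Import all_classical.

Set Implicit Arguments.
Unset Strict Implicit.
Unset Printing Implicit Defensive.

Local Open Scope classical_set_scope.
Local Open Scope card_scope.

(** An element fails to be [A]-typical exactly when it lies in [~` ext phi] for
some typical property [phi], and each of these sets has fewer than [|M|]
elements. There are at most [max(aleph_0, |A|) < cf |M|] properties, and a
union of fewer than [cf |M|] sets of size less than [|M|] has size less than
[|M|]; so the atypical elements form a small set, and what remains of [M] has
full cardinality.

The set-theoretic core is [few_lt_cofinality]. Let [R] well-order [M] in the
order type of a cardinal. By [card_le_or_rank], a form of the comparability of
cardinals, every set that is small relative to [M] injects into an initial
segment of [R]. Fewer than [cf |M|] such segments have a common strict upper
bound [z], and [z] can be chosen so that the index set injects into the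
segment of [z] as well. The union then injects into the square of that
segment, which is either finite or no larger than the segment itself
([card_le_segment_square], proved along Goedel's ordering of pairs), hence
smaller than [M].

The cardinal arithmetic behind the count of properties is replaced by closure
properties. Call an index set few if every union of small subsets of [M]
indexed by it is small. Unions of few sets over few indices are few, because
unions of unions are unions; this yields products, finite powers and sets
generated in countably many stages, in particular terms and formulas over a
signature with few symbols. Only [nat] and [A] are compared with the
cofinality directly. The same closure, for an index set with two elements,
shows that [M] is not the union of two small sets, so the typical elements,
whose complement is small, are as many as [M]. *)

(** * Cardinal comparison through partial surjections *)

(** Exhibiting an injection between subsets requires a default value in the
codomain; a partial surjection in the other direction avoids this, and
composes well with unions and products. *)
Lemma card_le_psurj (T U : Type) (A : set T) (B : set U) :
  A #<= B <-> exists g : U -> option T, some @` A `<=` g @` B.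
Proof.
split=> [/card_leP[f]|[g gAB]]; last first.
  rewrite -card_ge_some; apply: card_le_trans (subset_card_le gAB) _.
  exact: card_image_le.
pose P b a := val (f a) = b.
exists (fun b => if pselect (exists a, P b a) is left e then
  Some (val (projT1 (cid e))) else None).
move=> _ [a Aa <-]; set a' : set_type A := SigSub (mem_set Aa).
exists (val (f a')); first exact: set_valP.
case: pselect => [e|[]]; last by exists a'.
case: (cid e) => /= b; rewrite /P => fba.
suff -> : b = a' by [].
apply: (inj (f := f)); rewrite ?in_setE //.
exact: val_inj.
Qed.

Lemma card_le_setX (T U V W : Type) (A : set T) (B : set U) (C : set V)
  (D : set W) : A #<= B -> C #<= D -> A `*` C #<= B `*` D.
Proof.
move=> /card_le_psurj[g gAB] /card_le_psurj[h hCD]; apply/card_le_psurj.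
exists (fun p => if (g p.1, h p.2) is (Some a, Some c) then Some (a, c)
  else None).
move=> _ [[a c] /= [Aa Cc] <-].
have [b Bb gb] : (g @` B) (Some a) by apply: gAB; exists a.
have [d Dd hd] : (h @` D) (Some c) by apply: hCD; exists c.
by exists (b, d) => //=; rewrite gb hd.
Qed.

Lemma card_le_bigcup (T U V : Type) (I : set U) (F : U -> set T) (B : set V) :
  (forall i, I i -> F i #<= B) -> \bigcup_(i in I) F i #<= I `*` B.
Proof.
move=> FB.
have /choice[g gP] : forall i, exists g : V -> option T,
    I i -> some @` F i `<=` g @` B.
  move=> i; case: (pselect (I i)) => [/FB/card_le_psurj[g gP]|nIi].
    by exists g.
  by exists (fun=> None) => /nIi.
apply/card_le_psurj; exists (fun p => g p.1 p.2) => _ [x [i Ii Fx] <-].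
have [b Bb gb] : (g i @` B) (Some x) by apply: gP => //; exists x.
by exists (i, b).
Qed.

(** Hilbert's hotel, written backwards as a surjection: along an injective
sequence [s] in [A], the guest [s m.+1] stands for [s m] and [s 0] for the
newcomer [x]. *)
Lemma card_le_setU1 (T : Type) (A : set T) (x : T) :
  infinite_set A -> x |` A #<= A.
Proof.
move=> /infiniteP/card_le_psurj[g gA].
(* [g] being a left inverse of [s] lets it recognize the entries of [s]. *)
have /choice[s sP] : forall n, exists a, A a /\ g a = Some n.
  by move=> n; have [|a Aa ga] := gA (Some n); [exists n | exists a].
have sA n : A (s n) by case: (sP n).
have gs n : g (s n) = Some n by case: (sP n).
apply/card_le_psurj.
exists (fun a => Some (if g a is Some n then
  (if pselect (a = s n) then (if n is m.+1 then s m else x) else a) else a)).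
move=> _ [y [->|Ay] <-].
  by exists (s 0); rewrite // gs; case: pselect.
case: (pselect (exists n, y = s n)) => [[n ->]|ns].
  by exists (s n.+1); rewrite // gs; case: pselect.
exists y => //; case: (g y) => // n; case: pselect => // yn.
by case: ns; exists n.
Qed.

(** * Well-orders *)

Section WellOrder.
Variables (T : Type) (R : rel T).
Hypothesis Rwo : wochoice.well_order R.

Lemma wo_min (P : set T) : P !=set0 -> exists2 z, P z & forall y, P y -> R z y.
Proof.
move=> [x Px]; have [|z [[]]] := @Rwo (fun y => `[< P y >]).
  by exists x; apply/asboolP.
move=> /asboolP Pz zmin _; exists z => // y Py.
by apply: zmin; apply/asboolP.
Qed.

Lemma wo_total x y : R x y \/ R y x.
Proof.
have [|z [->|->] zmin] := @wo_min [set x; y]; first by exists x; left.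
  by left; apply: zmin; right.
by right; apply: zmin; left.
Qed.

Lemma wo_refl x : R x x.
Proof. by case: (wo_total x x). Qed.

Lemma wo_antisym x y : R x y -> R y x -> x = y.
Proof.
move=> xy yx; have [|z [_ zuniq]] := @Rwo (fun u => `[< u = x \/ u = y >]).
  by exists x; apply/asboolP; left.
have zx : z = x.
  apply: zuniq; split; first by apply/asboolP; left.
  by move=> u /asboolP[]->//; exact: wo_refl.
have zy : z = y.
  apply: zuniq; split; first by apply/asboolP; right.
  by move=> u /asboolP[]->//; exact: wo_refl.
by rewrite -zx -zy.
Qed.

Lemma wo_trans y x z : R x y -> R y z -> R x z.
Proof.
move=> xy yz; have [|u uP umin] := @wo_min [set u | [\/ u = x, u = y | u = z]].
  by exists x; constructor 1.
have ux : R u x by apply: umin; constructor 1.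
have uy : R u y by apply: umin; constructor 2.
have uz : R u z by apply: umin; constructor 3.
case: uP => ?; subst u => //; first by rewrite (wo_antisym xy ux).
by rewrite -(wo_antisym yz uy).
Qed.

Definition segment x := [set y | R y x /\ y <> x].

Lemma segmentPn x y : ~ R x y -> segment x y.
Proof.
move=> nxy; split; first by case: (wo_total x y).
by move=> yx; apply: nxy; rewrite yx; exact: wo_refl.
Qed.

Lemma segment_sub x y : R x y -> segment x `<=` segment y.
Proof.
move=> xy z [zx nzx]; split; first exact: wo_trans xy.
by move=> zy; apply: nzx; apply: wo_antisym => //; rewrite zy.
Qed.

Lemma segment_closed_sub x y : segment y x -> [set z | R z x] `<=` segment y.
Proof.
move=> [xy nxy] z zx; split; first exact: wo_trans xy.
by move=> zy; apply: nxy; apply: wo_antisym => //; rewrite -zy.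
Qed.

(** Stated for a rank function [r] into [T], since orders on pairs by their
maximum are needed as well as [R] itself. *)
Lemma wo_wf (V : Type) (r : V -> T) :
  well_founded (fun v w => segment (r w) (r v)).
Proof.
suff H x v : R (r v) x -> Acc (fun v w => segment (r w) (r v)) v.
  by move=> v; apply: (H (r v)); exact: wo_refl.
apply: contrapT => nacc.
have [|_ [w nw <-] wmin] :=
    @wo_min (r @` [set v | ~ Acc (fun v w => segment (r w) (r v)) v]).
  exists (r v), v => //; move=> a; apply: nacc => _; exact: a.
apply: nw; constructor => u uw; apply: contrapT => nu.
have wu : R (r w) (r u) by apply: wmin; exists u.
by case: uw => uw []; exact: wo_antisym.
Qed.

End WellOrder.

Lemma well_order_exists (T : Type) : exists R : rel T, wochoice.well_order R.
Proof. by have [R] := wochoice.well_ordering_principle {classic T}; exists R. Qed.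

(** Match the elements of [W] greedily with unused elements of [X], in order of
rank, breaking ties by an arbitrary well-order [Q] of [V]. Either every [w]
gets a partner and [W] embeds into [X], or [X] is exhausted when some [w] is
reached, and is then covered by the elements of [W] below [w]. For [r] the
identity this compares an arbitrary cardinal with a well-ordered one; for [r]
the maximum of a pair it is the comparison with Goedel's ordering. *)
Lemma card_le_or_rank (T : Type) (R : rel T) (Rwo : wochoice.well_order R)
    (V : Type) (r : V -> T) (W : set V) (U : Type) (X : set U) :
  W #<= X \/ exists2 w, W w & X #<= [set v | W v /\ R (r v) (r w)].
Proof.
have [Q Qwo] := well_order_exists V.
pose lt v w := segment R (r w) (r v) \/ r v = r w /\ segment Q w v.
have lt_wf : well_founded lt.
  move=> w; elim/(well_founded_ind (wo_wf Rwo r)) : w => w IHr.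
  have : r w = r w by [].
  move: {-2}w; elim/(well_founded_ind (wo_wf Qwo id)) => v IHQ vw.
  constructor => u [|[uv uQ]]; first by rewrite vw => /IHr.
  by apply: IHQ => //; rewrite uv.
have lt_total v w : v <> w -> lt v w \/ lt w v.
  move=> vw; case: (pselect (r v = r w)) => rvw.
    case: (wo_total Qwo v w) => Qvw; [left|right]; right; split=> //; split=> //.
    exact: nesym.
  by case: (wo_total Rwo (r v) (r w)) => Rvw; [left|right]; left; split=> //;
    exact: nesym.
have lt_rank v w : lt v w -> R (r v) (r w).
  by case=> [[]//|[-> _]]; exact: wo_refl.
(* [g w] is a chosen element of [X] not yet used below [w], if there is one. *)
pose fresh w (g : forall v, lt v w -> option U) u :=
  X u /\ forall v (vw : lt v w), W v -> g v vw <> Some u.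
pose step w g := if pselect (exists u, fresh w g u) is left e
  then Some (projT1 (cid e)) else None.
pose g := Fix lt_wf (fun=> option U) step.
have gE w : g w = step w (fun v _ => g v).
  rewrite /g Fix_eq // => x f h fh; congr step.
  by apply: functional_extensionality_dep => y;
    apply: functional_extensionality_dep.
case: (pselect (exists2 w, W w & g w = None)) => [[w Ww gw]|gN].
  right; exists w => //.
  apply: (@card_le_trans _ _ _ [set v | W v /\ lt v w]); last first.
    by apply: subset_card_le => v [Wv /lt_rank].
  apply/card_le_psurj; exists g => _ [u Xu <-]; apply: contrapT => nu.
  move: gw; rewrite gE /step; case: pselect => // -[]; exists u; split=> //.
  by move=> v vw Wv gv; apply: nu; exists v.
left.
have gP w : W w -> exists2 u, g w = Some u & fresh w (fun v _ => g v) u.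
  move=> Ww; rewrite gE /step; case: pselect => [e|ne].
    by exists (projT1 (cid e)) => //; case: (cid e).
  by case: gN; exists w; rewrite // gE /step; case: pselect.
have ginj : {in W &, injective g}.
  move=> v w /set_mem Wv /set_mem Ww gvw; apply: contrapT => /lt_total[] h.
    have [u gu [_ /(_ v h Wv)]] := gP w Ww; by rewrite gvw gu.
  have [u gu [_ /(_ w h Ww)]] := gP v Wv; by rewrite -gvw gu.
rewrite -(card_le_eql (inj_card_eq ginj)) -card_le_some.
apply: subset_card_le => _ [w /gP[u -> [Xu _]] <-].
by exists u.
Qed.

(** Induction on [x]. If the square of the segment does not embed into the
segment, then by [card_le_or_rank] the segment embeds into the pairs whose
maximum is at most some [c] below [x]. Those lie in the square of the segment
of [c] with [c] adjoined, which by [card_le_setU1] and induction is no larger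
than the segment of [c]; so both segments have the same cardinality and the
claim for [c] transfers to [x]. *)
Lemma card_le_segment_square (T : Type) (R : rel T)
    (Rwo : wochoice.well_order R) (x : T) :
  infinite_set (segment R x) -> segment R x `*` segment R x #<= segment R x.
Proof.
elim/(well_founded_ind (wo_wf Rwo id)) : x => x IH xinf.
pose max (p : T * T) := if R p.1 p.2 then p.2 else p.1.
have [//|[[a b] [/= ax bx] le_x]] :=
  card_le_or_rank Rwo max (segment R x `*` segment R x) (segment R x).
pose c := max (a, b).
have cx : segment R x c by rewrite /c /max /=; case: ifP.
have {}le_x : segment R x #<= (c |` segment R c) `*` (c |` segment R c).
  apply: card_le_trans le_x _; apply: subset_card_le => -[u v] /= [_].
  rewrite -/c => uvc.
  suff [uc vc] : R u c /\ R v c.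
    by split=> /=; [case: (pselect (u = c))|case: (pselect (v = c))];
      by [left|right].
  move: uvc; rewrite {1}/max /=; case: ifPn => [uv vc|/negP nuv uc].
    by split=> //; exact: wo_trans vc.
  split=> //; apply: wo_trans uc => //.
  by case: (wo_total Rwo u v).
have cinf : infinite_set (segment R c).
  move=> cfin; apply: xinf; apply: card_le_finite le_x _.
  by apply: finite_setX; rewrite finite_setU; split.
have le_xc : segment R x #<= segment R c.
  apply: card_le_trans le_x _.
  apply: card_le_trans (IH c cx cinf).
  by apply: card_le_setX; exact: card_le_setU1.
apply: card_le_trans (card_le_setX le_xc le_xc) _.
apply: card_le_trans (IH c cx cinf) _.
by apply: subset_card_le; apply: (segment_sub Rwo); case: cx.
Qed.

(** * Unions of few small sets *)

(** For subsets of [M] this is [|X| < |M|]; leaving out [X #<= [set: M]] lets it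
apply to sets in other types. *)
Definition small (M T : Type) (X : set T) := ~ ([set: M] #<= X).

(** A stand-in for [|I| < cf |M|] that is closed under unions by definition; for
the cardinal inequality the same closure would need the square theorem for
arbitrary cardinals and the regularity of [cf |M|]. *)
Definition few (M U : Type) (I : set U) := forall F : U -> set M,
  (forall i, I i -> small M (F i)) -> small M (\bigcup_(i in I) F i).

Lemma card_le_small (M T U : Type) (X : set T) (Y : set U) :
  X #<= Y -> small M Y -> small M X.
Proof. by move=> XY smallY MX; apply: smallY; exact: card_le_trans XY. Qed.

(** The segments into which the [F i] embed are indexed by [I], so their bounds
cannot be cofinal; a strict upper bound [z] makes them embed into a common
segment. A further bound [z'] beyond both [z] and the bound [y] for [I]
confines the union to the square of a single proper segment. *)
Lemma few_lt_cofinality (M : Type) (K : set M) (U : Type) (I : set U) :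
  is_cofinality M K -> ~ (K #<= [set: nat]) -> ~ (K #<= I) -> few M I.
Proof.
move=> [R [Rwo Rinit] [_ Kmin]] Knat KI F Fsmall.
have KM : K #<= [set: M] by exact: card_leT.
have smallfin (T : Type) (X : set T) : finite_set X -> small M X.
  move=> /finite_set_countable Xc MX; apply: Knat.
  exact: card_le_trans KM (card_le_trans MX Xc).
have segsmall x : small M (segment R x) by case: (Rinit x).
have small_seg (T : Type) (X : set T) : small M X ->
    exists x, X #<= [set y | R y x].
  move=> Xsmall; have [//|[x _ Xx]] := card_le_or_rank Rwo id [set: M] X.
  by exists x; apply: card_le_trans Xx _; apply: subset_card_le => y [].
(* A family indexed by fewer than [cf |M|] elements is not cofinal, and a
   witness of this lies strictly above the family. *)
have strict_bound (T : Type) (J : set T) (x : T -> M) : ~ (K #<= J) ->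
    exists z, forall j, J j -> segment R z (x j).
  move=> KJ; apply: contrapT => /forallNP nz; apply: KJ.
  apply: card_le_trans (Kmin (x @` J) _) (card_image_le _ _) => z.
  apply: contrapT => nzJ; apply: (nz z) => j Jj.
  by apply: (segmentPn Rwo) => zj; apply: nzJ; exists (x j) => //; exists j.
have [y Iy] : exists y, I #<= [set z | R z y].
  by apply: small_seg => MI; apply: KI; exact: card_le_trans MI.
have /choice[x xP] : forall i, exists x, I i -> F i #<= [set z | R z x].
  move=> i; case: (pselect (I i)) => [/Fsmall/small_seg[x xP]|nIi].
    by exists x.
  by exists y => /nIi.
have [z zP] := strict_bound _ I x KI.
have [z' z'P] : exists z', forall b : bool, [set: bool] b ->
    segment R z' (if b then z else y).
  apply: strict_bound => Kbool; apply: Knat; apply: card_le_trans Kbool _.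
  exact: finite_set_countable.
have Iz' : I #<= segment R z'.
  apply: card_le_trans Iy (subset_card_le _).
  exact: (segment_closed_sub Rwo (z'P false _)).
have Fz' i : I i -> F i #<= segment R z'.
  move=> Ii; apply: card_le_trans (xP i Ii) (subset_card_le _).
  apply: (segment_closed_sub Rwo); apply: (segment_sub Rwo) (zP i Ii).
  by case: (z'P true).
have Usq : \bigcup_(i in I) F i #<= segment R z' `*` segment R z'.
  apply: card_le_trans (card_le_bigcup Fz') _.
  exact: card_le_setX.
apply: (card_le_small Usq).
case: (pselect (finite_set (segment R z'))) => [fin|inf].
  by apply: smallfin; exact: finite_setX.
exact: card_le_small (card_le_segment_square Rwo inf) (segsmall z').
Qed.

Section Few.
Variables (M : Type) (m0 : M).
Hypothesis few_nat : few M [set: nat].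

(** Reindex along a partial surjection [g] from [J] to [I]. An index that [g]
does not send into [I] contributes the empty set, which is small because [m0]
makes [M] nonempty. *)
Lemma few_card_le (U V : Type) (I : set U) (J : set V) :
  I #<= J -> few M J -> few M I.
Proof.
move=> /card_le_psurj[g gIJ] fewJ F Fsmall.
pose G j := \bigcup_(i in [set i | I i /\ g j = Some i]) F i.
have FG : \bigcup_(i in I) F i `<=` \bigcup_(j in J) G j.
  move=> a [i Ii Fia]; have [|j Jj gj] := gIJ (Some i); first by exists i.
  by exists j => //; exists i.
apply: (card_le_small (subset_card_le FG)); apply: fewJ => j Jj.
rewrite /G; case gj : (g j) => [i|]; last first.
  rewrite (_ : [set _ | _] = set0); last by apply/seteqP; split=> // i [].
  by rewrite bigcup_set0 => /card_le0P M0; have : set0 m0 by rewrite -M0.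
case: (pselect (I i)) => Ii.
  apply: card_le_small (Fsmall i Ii); apply: subset_card_le.
  by move=> a [k [_ [<-]]].
rewrite (_ : [set _ | _] = set0).
  by rewrite bigcup_set0 => /card_le0P M0; have : set0 m0 by rewrite -M0.
by apply/seteqP; split=> // k [Ik [ik]]; apply: Ii; rewrite ik.
Qed.

Lemma few_subset (U : Type) (I J : set U) : I `<=` J -> few M J -> few M I.
Proof. by move=> /subset_card_le/few_card_le. Qed.

Lemma few_image (U V : Type) (f : U -> V) (I : set U) :
  few M I -> few M (f @` I).
Proof. exact/few_card_le/card_image_le. Qed.

Lemma few_countable (U : Type) (I : set U) : countable I -> few M I.
Proof. by move=> cI; exact: few_card_le cI few_nat. Qed.

Lemma few_bigcup (U V : Type) (I : set U) (J : U -> set V) :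
  few M I -> (forall i, I i -> few M (J i)) -> few M (\bigcup_(i in I) J i).
Proof.
move=> fewI fewJ F Fsmall; rewrite bigcup_bigcup; apply: fewI => i Ii.
by apply: fewJ => // j Jj; apply: Fsmall; exists i.
Qed.

Lemma few_setU (U : Type) (I J : set U) :
  few M I -> few M J -> few M (I `|` J).
Proof.
move=> fewI fewJ.
have IJ : I `|` J `<=` \bigcup_(b in [set: bool]) (if b then I else J).
  by move=> x [Ix|Jx]; [exists true | exists false].
apply: few_subset IJ _; apply: few_bigcup => [|[]//].
exact/few_countable/finite_set_countable.
Qed.

Lemma few_setX (U V : Type) (I : set U) (J : set V) :
  few M I -> few M J -> few M (I `*` J).
Proof.
move=> fewI fewJ.
have IJ : I `*` J `<=` \bigcup_(i in I) (pair i @` J).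
  by move=> [i j] [/= Ii Jj]; exists i => //; exists j.
by apply: few_subset IJ _; apply: few_bigcup => // i _; exact: few_image.
Qed.

Lemma few_ffun (U : Type) (I : set U) n :
  few M I -> few M [set f : 'I_n -> U | forall k, I (f k)].
Proof.
move=> fewI; elim: n => [|n IHn].
  apply/few_countable/finite_set_countable.
  case: (pselect (exists f : 'I_0 -> U, True)) => [[f0 _]|nf].
    apply: (@sub_finite_set _ _ [set f0]); last exact: finite_set1.
    by move=> f _; apply/funext => -[].
  by apply: (@sub_finite_set _ _ set0) => // f; case: nf; exists f.
pose cons (p : U * ('I_n -> U)) (k : 'I_n.+1) :=
  if unlift ord0 k is Some j then p.2 j else p.1.
have few_cons := few_image (f := cons) (few_setX fewI IHn).
apply: few_subset few_cons => f fI.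
exists (f ord0, fun j => f (lift ord0 j)); first by split=> //= j.
by apply/funext => k; rewrite /cons; case: unliftP => [j ->|->].
Qed.

(** * Few formulas *)

(** The inductive types below are exhausted by countably many stages of a
constructor step, which gives an upper bound on their size without any coding
of syntax trees. *)
Lemma few_generated (U : Type) (step : set U -> set U) :
  (forall I, few M I -> few M (step I)) ->
  few M (\bigcup_n iter n step set0).
Proof.
move=> step_few; apply: few_bigcup => // n _; elim: n => [|n IHn] /=.
  exact: few_countable.
exact: step_few.
Qed.

Section Generated.
Variables (U : Type) (step : set U -> set U).
Hypothesis step_mono : forall I J, I `<=` J -> step I `<=` step J.

Lemma iter_step_sub m n : m <= n -> iter m step set0 `<=` iter n step set0.
Proof.
elim: m n => [|m IHm] [|n] //= mn; try exact: sub0set.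
by apply: step_mono; exact: IHm.
Qed.

(** Finitely many generated elements already appear at a common stage; this is
what makes a term with a tuple of arguments appear at the next one. *)
Lemma generated_finite k (u : 'I_k -> U) :
  (forall i, (\bigcup_n iter n step set0) (u i)) ->
  exists n, forall i, iter n step set0 (u i).
Proof.
move=> ugen; have /choice[n nP] : forall i, exists n, iter n step set0 (u i).
  by move=> i; have [n] := ugen i; exists n.
exists (\max_i n i) => i; apply: iter_step_sub (nP i).
exact: leq_bigmax.
Qed.

End Generated.

Section Syntax.
Variable L : language.
Hypotheses (few_fsym : few M [set: Defs.fsym L])
  (few_rsym : few M [set: rsym L]).

Definition term_step (I : set (term L)) : set (term L) :=
  range Var `|`
  \bigcup_(f in [set: Defs.fsym L])
    (@App L f @` [set ts | forall k, I (ts k)]).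

Lemma few_terms : few M [set: term L].
Proof.
apply: (@few_subset _ _ (\bigcup_n iter n term_step set0)); last first.
  apply: few_generated => I fewI; apply: few_setU; first exact: few_image.
  by apply: few_bigcup => // f _; apply: few_image; exact: few_ffun.
have mono I J : I `<=` J -> term_step I `<=` term_step J.
  move=> IJ t [tv|[f _ [ts tsI <-]]]; first by left.
  by right; exists f => //; exists ts => // k; exact/IJ/tsI.
move=> t _; elim: t => [x|f ts IHts]; first by exists 1 => //; left; exists x.
have [n nP] := generated_finite mono IHts.
by exists n.+1 => //; right; exists f => //; exists ts.
Qed.

Definition formula_step (I : set (formula L)) : set (formula L) :=
  [set Bot]
  `|` (fun p => Eq p.1 p.2) @` ([set: term L] `*` [set: term L])
  `|` \bigcup_(r in [set: rsym L]) range (@Rel L r)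
  `|` (fun p => Imp p.1 p.2) @` (I `*` I)
  `|` (fun p => All p.1 p.2) @` ([set: nat] `*` I).

Lemma few_formulas : few M [set: formula L].
Proof.
apply: (@few_subset _ _ (\bigcup_n iter n formula_step set0)); last first.
  apply: few_generated => I fewI.
  repeat apply: few_setU.
  - exact/few_countable/finite_set_countable/finite_set1.
  - exact/few_image/few_setX/few_terms/few_terms.
  - apply: few_bigcup => // r _; apply: few_image.
    have few_args := few_ffun (n := rarity r) few_terms.
    by apply: few_subset few_args => ts _ k.
  - by apply: few_image; exact: few_setX.
  - by apply: few_image; exact: few_setX.
have mono I J : I `<=` J -> formula_step I `<=` formula_step J.
  move=> IJ; apply: setUSS; first apply: setUS.
    by apply: image_subset => p [/= /IJ ? /IJ].
  by apply: image_subset => p [/= ? /IJ].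
have le_gen m n phi : m <= n -> iter m formula_step set0 phi ->
    iter n formula_step set0 phi.
  by move=> mn; exact: iter_step_sub.
move=> phi _; elim: phi =>
  [|s t|r ts|phi [m _ IHphi] psi [n _ IHpsi]|x phi [n _ IHphi]].
- by exists 1 => //; left; left; left; left.
- by exists 1 => //; left; left; left; right; exists (s, t).
- by exists 1 => //; left; left; right; exists r => //; exists ts.
- exists (maxn m n).+1 => //; left; right; exists (phi, psi) => //; split=> /=.
    exact: le_gen (leq_maxl _ _) IHphi.
  exact: le_gen (leq_maxr _ _) IHpsi.
- by exists n.+1 => //; right; exists (x, phi).
Qed.

(** The third field of a property is a proof, so the formula and the variable
determine it. *)
Lemma few_properties : few M [set: property L].
Proof.
pose code (phi : property L) := (prop_formula phi, prop_var phi).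
have code_inj : {in [set: property L] &, injective code}.
  move=> [phi x hx] [psi y hy] _ _ [/= e1 e2]; subst psi y.
  by rewrite (Prop_irrelevance hx hy).
have few_codes := few_setX few_formulas few_nat.
apply: few_card_le few_codes; rewrite -(card_le_eql (inj_card_eq code_inj)).
exact: subset_card_le.
Qed.

End Syntax.
End Few.

(** * Typical elements *)

Theorem theorem2p9 (L : language) (hL : countable_language L)
    (M : Type) (S : structure L M) (A : set M)
    (K : set M) (hK : is_cofinality M K)
    (hcf : card_lt [set: nat] K /\ card_lt A K) :
  [set a | typical S A a] #= [set: M] /\
  card_lt [set a | ~ typical S A a] [set: M].
Proof.
have [[_ Knat] [_ KA]] := hcf; have [fsymL rsymL] := hL.
have [m0 _] : [set: M] !=set0.
  apply/set0P/eqP => M0; apply: Knat.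
  by apply: card_le_trans (card_leT _) _; rewrite M0.
have few_nat : few M [set: nat] by exact: few_lt_cofinality hK _ _.
have few_fsym : few M [set: Defs.fsym (lang_params L A)].
  have sumT : [set: Defs.fsym L + set_type A] `<=` range inl `|` range inr.
    by move=> [f|a] _; [left; exists f | right; exists a].
  apply: (few_subset m0 sumT).
  apply: (few_setU m0 few_nat); apply: (few_image m0).
    exact: few_countable.
  apply: (few_card_le m0 (J := A)); last exact: few_lt_cofinality hK _ _.
  have val_inj' : {in [set: set_type A] &, injective val}.
    by move=> a b _ _ /val_inj.
  rewrite -(card_le_eql (inj_card_eq val_inj')).
  by apply: subset_card_le => _ [a _ <-]; exact: set_valP.
have few_rsym : few M [set: rsym (lang_params L A)] by exact: few_countable.
have small_atypical : small M [set a | ~ typical S A a].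
  have fewP := few_properties m0 few_nat few_fsym few_rsym.
  have sub_ext : [set a | ~ typical S A a] `<=`
      \bigcup_(phi in @typical_property L M S A) ~` ext S phi.
    move=> a /= atyp; apply: contrapT => nex; apply: atyp => phi phityp.
    by apply: contrapT => nphi; apply: nex; exists phi.
  apply: (card_le_small (subset_card_le sub_ext)).
  apply: (few_subset m0 (I := @typical_property L M S A) _ fewP) => //.
  move=> phi [_ nle] Mle; apply: nle.
  exact: card_le_trans (card_leT _) Mle.
split; last by split; first exact: card_leT.
apply: Cantor_Bernstein; first exact: card_leT.
apply: contrapT => small_typical.
have few_bool : few M [set: bool].
  exact/(few_countable m0 few_nat)/finite_set_countable.
(* Otherwise [M] itself would be a union of two small sets. *)
apply: (few_bool (fun b => if b then [set a | typical S A a]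
  else [set a | ~ typical S A a])) => [[]//|].
apply: subset_card_le => a _.
by case: (pselect (typical S A a)) => ha; [exists true|exists false].
Qed.
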